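(* Let $\mathcal{M}=(W,\preceq,V)$ and $\mathcal{N}=(W,\preceq^{\mathcal N},V)$ be the two single-agent ($Ag=\{a\}$) plausibility models with $W=\{w,v\}$, $w\neq v$, $V(p)=\{v\}$ (so $p$ is false at $w$ and true at $v$), where $\preceq_a=\{(w,w),(v,v),(w,v)\}$ (so $w$ is strictly more plausible than $v$ in $\mathcal{M}$) and $\preceq_a^{\mathcal N}=W\times W$ (so $w$ and $v$ are equally plausible in $\mathcal{N}$). Then there is no plausibility event model $\mathcal{E}$ such that $\mathcal{M}\ast\mathcal{E}\equiv\mathcal{N}$, where $\ast$ denotes plausibility update and $\equiv$ denotes modal equivalence with respect to the doxastic language $\mathcal{L}$.
   Context: Language. $At$ is a countable set of atoms (with $p\in At$), $Ag$ a finite set of agents. The doxastic language $\mathcal{L}$ is given by $\varphi::=\top\mid p\mid\neg\varphi\mid\varphi\wedge\varphi\mid B_a\varphi$ with $p\in At$, $a\in Ag$. Plausibility models. A plausibility order on a set $S$ is a connected (total), reflexive and transitive relation $\trianglelefteq\subseteq S\times S$ such that every non-empty $S'\subseteq S$ has a minimal element, i.e. $Min_{\trianglelefteq}(S')=\{w\in S':\forall v\in S',\ w\trianglelefteq v\}\neq\emptyset$. A plausibility model is a triple $(W,\preceq,V)$ with $W\neq\emptyset$, $\preceq_a$ a plausibility order on $W$ for each $a\in Ag$ ($x\preceq_a y$ means $x$ is at least as plausible as $y$), and $V:At\to\wp(W)$. Semantics: atoms and Boolean connectives as usual, and $\mathcal{M},w\vDash B_a\varphi$ iff $\mathcal{M},v\vDash\varphi$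 for all $v\in Min_{\preceq_a}(W)$. Plausibility event models. A plausibility event model is $\mathcal{E}=(E,\leq,pre)$ with $E$ a non-empty finite set, $\leq_a$ a plausibility order on $E$ for each $a\in Ag$, and $pre:E\to\mathcal{L}$. Write $e<_a f$ for $e\leq_a f$ and $f\not\leq_a e$, and $e\equiv_a f$ for $e\leq_a f$ and $f\leq_a e$. Plausibility update. $\mathcal{M}\ast\mathcal{E}=(W^{\mathcal E},\preceq^{\mathcal E},V^{\mathcal E})$ where $W^{\mathcal E}=\{(w,e)\in W\times E:\mathcal{M},w\vDash pre(e)\}$; $(w,e)\preceq_a^{\mathcal E}(v,f)$ iff $e<_a f$, or $e\equiv_a f$ and $w\preceq_a v$; and $V^{\mathcal E}(p)=\{(w,e)\in W^{\mathcal E}:w\in V(p)\}$. Modal equivalence. Two models $\mathcal{K}$ and $\mathcal{K}'$ with sets of worlds $W,W'$ are modally equivalent with respect to $\mathcal{L}$, written $\mathcal{K}\equiv\mathcal{K}'$, if for every formula $\varphi\in\mathcal{L}$ and every $w\in W$ there exists $w'\in W'$ such that $\mathcal{K},w\vDash\varphi$ iff $\mathcal{K}',w'\vDash\varphi$, and conversely, for every $w'\in W'$ there exists $w\in W$ with the same property. *)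

(* Defs.v *)
From mathcomp Require Import all_boot.
From mathcomp Require Import boolp classical_sets.

Set Implicit Arguments.
Unset Strict Implicit.
Unset Printing Implicit Defensive.

Local Open Scope classical_set_scope.

Inductive formula (At Ag : Type) : Type :=
| Top
| Atom of At
| Neg of formula At Ag
| And of formula At Ag & formula At Ag
| Bel of Ag & formula At Ag.

Arguments Top {At Ag}.
Arguments Atom {At Ag}.

(* A relation on [S] is a subset of [S * S]; [R (x, y)] reads "[x] is at least
   as plausible as [y]", so minimal elements are the most plausible ones. *)
Definition Min (S : Type) (R : set (S * S)) (A : set S) : set S :=
  [set x | A x /\ forall y, A y -> R (x, y)].

Record plausibility_order (S : Type) (R : set (S * S)) : Prop := {
  po_total : forall x y, R (x, y) \/ R (y, x);
  po_refl : forall x, R (x, x);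
  po_trans : forall x y z, R (x, y) -> R (y, z) -> R (x, z);
  po_min : forall A : set S, A !=set0 -> Min R A !=set0
}.

(* Structures without the order axioms or non-emptiness: the domain of a
   plausibility update may be empty, in which case the result is not a
   plausibility model. *)
Record structure (At Ag W : Type) : Type := Structure {
  plaus : Ag -> set (W * W);
  val_of : At -> set W
}.

Record plausibility_model (At Ag W : Type) : Type := PlausibilityModel {
  pm_structure :> structure At Ag W;
  pm_nonempty : [set: W] !=set0;
  pm_order : forall a, plausibility_order (plaus pm_structure a)
}.

Fixpoint sat (At Ag W : Type) (M : structure At Ag W) (w : W)
    (phi : formula At Ag) : Prop :=
  match phi with
  | Top => True
  | Atom p => val_of M p w
  | Neg psi => ~ sat M w psi
  | And psi chi => sat M w psi /\ sat M w chi
  | Bel a psi => forall v, Min (plaus M a) [set: W] v -> sat M v psi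
  end.

Record event_model (At Ag : Type) (E : finType) : Type := EventModel {
  ev_plaus : Ag -> set (E * E);
  pre : E -> formula At Ag;
  em_nonempty : [set: E] !=set0;
  em_order : forall a, plausibility_order (ev_plaus a)
}.

Definition strictly (S : Type) (R : set (S * S)) (e f : S) : Prop :=
  R (e, f) /\ ~ R (f, e).

Definition equally (S : Type) (R : set (S * S)) (e f : S) : Prop :=
  R (e, f) /\ R (f, e).

Definition update_world (At Ag W : Type) (E : finType)
    (M : structure At Ag W) (X : event_model At Ag E) : Type :=
  {x : W * E | sat M x.1 (pre X x.2)}.

Definition update (At Ag W : Type) (E : finType)
    (M : structure At Ag W) (X : event_model At Ag E) :
    structure At Ag (update_world M X) :=
  {| plaus := fun a => [set xy |
       let: (w, e) := sval xy.1 in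
       let: (v, f) := sval xy.2 in
       strictly (ev_plaus X a) e f \/
       equally (ev_plaus X a) e f /\ plaus M a (w, v)];
     val_of := fun p => [set x | val_of M p (sval x).1] |}.

(* The matching world may depend on the formula. *)
Definition modally_equivalent (At Ag W W' : Type)
    (K : structure At Ag W) (K' : structure At Ag W') : Prop :=
  (forall (phi : formula At Ag) (w : W),
     exists w' : W', sat K w phi <-> sat K' w' phi) /\
  (forall (phi : formula At Ag) (w' : W'),
     exists w : W, sat K w phi <-> sat K' w' phi).

(* Main.v *)
(** In [N] the agent believes neither [p] nor [~ p], so an update equivalent to
    [N] has most plausible worlds [(w, e)] and [(v, f)], which are therefore
    equally plausible. Lexicographic comparison then forces [e] and [f] to be
    equally plausible and hence [v] to be at least as plausible as [w] in [M],
    which is false. *)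
Require Import Defs.
From mathcomp Require Import all_boot.
From mathcomp Require Import boolp classical_sets.

Local Open Scope classical_set_scope.

Lemma not_Bel_witness (At Ag W : Type) (M : structure At Ag W) (x : W)
    (a : Ag) (phi : formula At Ag) :
  ~ sat M x (Bel a phi) ->
  exists2 y, Min (plaus M a) [set: W] y & ~ sat M y phi.
Proof. by move=> /existsNP[y /not_implyP[]]; exists y. Qed.

(** A strict comparison of events in one direction excludes both clauses of the lexicographic order
    in the other, so both directions come from the clause comparing worlds. *)
Lemma update_equally (At Ag W : Type) (E : finType) (M : structure At Ag W)
    (X : event_model At Ag E) (a : Ag) (x y : update_world M X) :
  equally (plaus (update M X) a) x y ->
  equally (plaus M a) (sval x).1 (sval y).1.
Proof.
by case: x y => [[w e] wP] [[v f] vP] [] /=; rewrite /strictly /equally; tauto.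
Qed.

Theorem theorem3p2 (At : countType) (p : At) (Ag : finType) (a : Ag)
    (hAg : [set: Ag] = [set a])
    (W : Type) (w v : W) (hwv : w <> v) (hW : [set: W] = [set w; v])
    (M N : plausibility_model At Ag W)
    (hMV : val_of M p = [set v])
    (hNV : val_of N = val_of M)
    (hM : plaus M a = [set (w, w); (v, v); (w, v)])
    (hN : plaus N a = [set: W * W]) :
  ~ exists (E : finType) (X : event_model At Ag E),
      modally_equivalent (update M X) N.
Proof.
move=> [E [X [_ back]]].
have minN z : Min (plaus N a) [set: W] z by rewrite hN.
have [x Bx] := back (Bel a (Atom p)) w.
have [|y ymin yNp] := @not_Bel_witness _ _ _ (update M X) x a (Atom p).
  by rewrite Bx => /(_ w (minN w)) /=; rewrite hNV hMV.
(* [x'] may differ from [x], harmlessly: the truth of a belief is the same at all worlds, and [y]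
   and [z] are minimal for the same order. *)
have [x' Bx'] := back (Bel a (Neg (Atom p))) w.
have [|z zmin /contrapT zp] :=
  @not_Bel_witness _ _ _ (update M X) x' a (Neg (Atom p)).
  by rewrite Bx' => /(_ v (minN v)) /=; rewrite hNV hMV; apply.
have yw : (sval y).1 = w.
  have : [set: W] (sval y).1 by [].
  by rewrite hW => -[//|yv]; case: yNp; rewrite /= hMV.
have zv : (sval z).1 = v by move: zp; rewrite /= hMV.
have [] : equally (plaus M a) w v.
  rewrite -yw -zv; apply: update_equally.
  by split; [apply: ymin.2|apply: zmin.2].
(* [(v, w)] can equal one of the three listed pairs only if [w = v]. *)
by move=> _; rewrite hM /= => -[[]|] [] *; apply: hwv.
Qed.
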